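(* Let $X$ be a metrizable space. Then the free topological vector space $\mathbb{V}(X)$ has countable tightness if and only if $X$ is separable.
   Context: All vector spaces are over $\mathbb{R}$; all topological spaces are Tychonoff (so topological vector spaces are Hausdorff). The free topological vector space over a Tychonoff space $X$ is a topological vector space $\mathbb{V}(X)$ together with a continuous map $i:X\to\mathbb{V}(X)$ such that for every continuous map $f$ from $X$ to a topological vector space $E$ there is a unique continuous linear operator $\bar f:\mathbb{V}(X)\to E$ with $f=\bar f\circ i$. A space $Z$ has countable tightness if whenever $A\subseteq Z$ and $x\in\overline{A}$, then $x\in\overline{B}$ for some countable $B\subseteq A$. *)

(* Defs.v *)
From HB Require Import structures.
From mathcomp Require Import all_boot all_order all_algebra.
From mathcomp Require Import boolp classical_sets functions cardinality reals.
From mathcomp Require Import topology normedtype.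
Set Implicit Arguments.
Unset Strict Implicit.
Unset Printing Implicit Defensive.
Local Open Scope classical_set_scope.
Local Open Scope ring_scope.

Definition homeomorphic (X Y : topologicalType) : Prop :=
  exists (h : X -> Y) (k : Y -> X),
    [/\ cancel h k, cancel k h, continuous h & continuous k].

Definition metrizable (R : realType) (X : topologicalType) : Prop :=
  exists M : metricType R, homeomorphic X M.

Definition separable (X : topologicalType) : Prop :=
  exists2 D : set X, countable D & dense D.

Definition countable_tightness (Z : topologicalType) : Prop :=
  forall (A : set Z) (x : Z), closure A x ->
    exists B : set Z, [/\ countable B, B `<=` A & closure B x].

(* [topologicalLmodType R] is the library's structure of (not necessarily
   Hausdorff, not necessarily locally convex) topological vector spaces; its
   [tvsType R] is restricted to the locally convex ones and is not the class
   meant here. Hausdorff topological vector spaces are Tychonoff. *)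
Definition is_free_tvs (R : realType) (X : topologicalType)
    (V : topologicalLmodType R) (i : X -> V) : Prop :=
  [/\ hausdorff_space V, continuous i &
    forall (E : topologicalLmodType R) (f : X -> E),
      hausdorff_space E -> continuous f ->
      exists! g : V -> E, [/\ linear g, continuous g & f = g \o i]].

(* Main.v *)
Require Import Defs.
From HB Require Import structures.
From mathcomp Require Import all_boot all_order all_algebra.
From mathcomp Require Import boolp classical_sets functions cardinality reals.
From mathcomp Require Import topology normedtype.
From mathcomp Require Import lra set_interval lebesgue_measure.

(** Why the theorem holds.

    Separable implies countably tight.  A space with a countable network
    (countably many sets, not necessarily open, such that each neighbourhood
    of each point contains one of them around that point) is countably tight:
    picking one point of A in each member that meets A gives a countable
    subset whose closure contains A ([countable_network_tightness]).  Countable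
    networks pass to products, continuous images and countable unions.  If X is
    separable metrizable then X and the real line have one, hence so has the
    set of linear combinations of n points of X, for each n, and so has the
    union of these sets, which is the linear span of X.  That span is the whole
    free space: given the induced topology it is a Hausdorff topological
    vector space, so the universal property sends V(X) into it, and by
    uniqueness the result is the identity of V(X) ([free_tvs_spanned]).

    Countably tight implies separable.  If the metric space M is not
    separable, Zorn's lemma gives e > 0 and an uncountable e-separated subset
    G whose points p carry pairwise distinct real labels r(p)
    ([nonseparable_separated]).  Let A be the set of all vectors
      |r(p) - r(q)| (p + q)    for p <> q in G.
    - The origin is in the closure of A ([closure_scaled_sums]).  For a
      neighbourhood W of 0, uncountably many p in G share one bound 1/(k+1)
      below which all multiples t p lie in W; among uncountably many labels
      two are closer than 1/(k+1), and this puts a point of A in W + W.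
    - The origin is not in the closure of a countable subset B of A.  Only
      countably many points of G occur in B, so their weights can be chosen
      inductively: there is a function a with
      a(p) + a(q) >= 1/|r(p) - r(q)| on these points
      ([countable_domination]).  As the points are e-separated, a extends to a
      continuous real function on M ([separated_interpolation]), hence to a
      continuous linear functional on V(X), and this functional is at least 1
      on B.
    Uncountably many labels are what makes the first point work; enumerating
    the points that occur is what makes the second one work. *)

Set Implicit Arguments.
Unset Strict Implicit.
Unset Printing Implicit Defensive.
Import Order.TTheory GRing.Theory Num.Theory.
Import numFieldNormedType.Exports.
Local Open Scope classical_set_scope.
Local Open Scope ring_scope.

(** * Linear subspaces as topological vector spaces *)

Section SubTVS.
Variables (R : realType) (V : topologicalLmodType R) (S : {pred V}).
Hypothesis S_closed : GRing.subsemimod_closed S.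

(** The closure proof is a phantom argument, so that the algebraic structure of
    the subspace can be inferred from the type alone. *)
Definition subtvs of GRing.subsemimod_closed S : Type := {v : V | v \in S}.
Local Notation W := (subtvs S_closed).

HB.instance Definition _ := SubChoice.copy W {v : V | v \in S}.
HB.instance Definition _ :=
  GRing.SubChoice_isSubLmodule.Build R V S W S_closed.
HB.instance Definition _ := Topological.copy W (initial_topology (val : W -> V)).

Lemma val_subtvs_continuous : continuous (val : W -> V).
Proof. exact: initial_continuous. Qed.

Lemma continuous_subtvs (T : topologicalType) (f : T -> W) :
  continuous (val \o f) -> continuous f.
Proof.
move=> fc; apply/continuousP => _ [A oA <-].
by move/continuousP : fc; exact.
Qed.

Let add_continuous : continuous (fun x : W * W => x.1 + x.2).
Proof.
apply: continuous_subtvs => x.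
apply: (@continuous_comp _ _ _ (fun x : W * W => (val x.1, val x.2))
  (fun x : V * V => x.1 + x.2)); last exact: add_continuous.
apply: cvg_pair => /=.
  apply: (@continuous_comp (W * W)%type W V fst val); first exact: cvg_fst.
  exact: val_subtvs_continuous.
apply: (@continuous_comp (W * W)%type W V snd val); first exact: cvg_snd.
exact: val_subtvs_continuous.
Qed.

Let scale_continuous : continuous (fun x : R^o * W => x.1 *: x.2).
Proof.
apply: continuous_subtvs => x.
apply: (@continuous_comp _ _ _ (fun x : R^o * W => (x.1, val x.2))
  (fun x : R^o * V => x.1 *: x.2)); last exact: scale_continuous.
apply: (@cvg_pair _ _ _ _ (nbhs (x.1 : R^o)) (nbhs (val x.2))) => /=.
  exact: cvg_fst.
apply: (@continuous_comp (R^o * W)%type W V snd val); first exact: cvg_snd.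
exact: val_subtvs_continuous.
Qed.

HB.instance Definition _ :=
  PreTopologicalNmodule_isTopologicalNmodule.Build W add_continuous.
HB.instance Definition _ :=
  TopologicalNmodule_isTopologicalLmodule.Build R W scale_continuous.

Lemma subtvs_hausdorff : hausdorff_space V -> hausdorff_space W.
Proof.
move=> hV x y xy; apply: val_inj; apply: hV => A B nA nB.
have [z [Az Bz]] := xy _ _ (val_subtvs_continuous nA) (val_subtvs_continuous nB).
by exists (val z).
Qed.

End SubTVS.

(** The corestriction of [i] to a subspace containing its range extends to V,
    and composing the extension with the inclusion gives a continuous linear
    endomorphism of V extending [i]; so does the identity, whence every vector
    is a value of the inclusion.  Passing through the subspace itself, and not a
    quotient of V, is what allows the subspace not to be closed. *)
Lemma free_tvs_spanned (R : realType) (X : topologicalType)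
    (V : topologicalLmodType R) (i : X -> V) (S : {pred V}) :
  is_free_tvs i -> GRing.subsemimod_closed S ->
  (forall x, i x \in S) -> forall v, v \in S.
Proof.
move=> [hV ci univ] clS iS v.
pose j x : subtvs clS := Sub (i x) (iS x).
have cj : continuous j by exact: continuous_subtvs.
have [g [[lg cg jE] _]] := univ _ _ (subtvs_hausdorff (S_closed := clS) hV) cj.
have [h [_ uniq_h]] := univ _ _ hV ci.
have hid : h = id.
  by apply: uniq_h; split => //; move=> x; exact: cvg_id.
have hval : h = val \o g.
  apply: uniq_h; split.
  - by move=> a x y /=; rewrite lg.
  - move=> x; apply: (@continuous_comp V (subtvs clS) V g val).
      exact: cg.
    exact: val_subtvs_continuous.
  - apply/funext => x /=.
    by have /= := congr1 (fun f => val (f x)) jE.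
by rewrite -[v]/(id v) -hid hval /=; exact: valP.
Qed.

(** * Countable networks *)

(** The network is relative to a subset [Y]: its members need not be included
    in [Y], which spares subspace topologies when [Y] is a countable union. *)
Definition countable_network (T : topologicalType) (Y : set T) : Prop :=
  exists2 N : set (set T), countable N &
    forall y U, Y y -> nbhs y U -> exists S, [/\ N S, S y & S `<=` U].

(** One point of [A] is picked in each member of the network that meets [A]. *)
Lemma countable_network_tightness (T : topologicalType) :
  countable_network [set: T] -> countable_tightness T.
Proof.
move=> [N cN netN] A x clAx.
exists [set xget x (S `&` A) | S in [set S | N S /\ S `&` A !=set0]].
split.
- apply: (card_le_trans (card_image_le _ _)).
  by apply: sub_countable cN; apply: subset_card_le => S [].
- by move=> _ [S [_ SA0] <-]; have [] := xgetPex x SA0.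
- move=> U /[dup] nU; rewrite nbhsE => -[O [oO Ox] OU].
  have [a [Aa Oa]] := clAx _ (open_nbhs_nbhs (conj oO Ox)).
  have [S [NS Sa SO]] := netN a O I (open_nbhs_nbhs (conj oO Oa)).
  have SA0 : S `&` A !=set0 by exists a.
  exists (xget x (S `&` A)); split; first by exists S.
  by apply/OU/SO; have [] := xgetPex x SA0.
Qed.

Lemma countable_network_image2 (S T V : topologicalType) (f : S * T -> V)
    (Y : set S) (Z : set T) :
  continuous f -> countable_network Y -> countable_network Z ->
  countable_network (f @` (Y `*` Z)).
Proof.
move=> cf [M cM netM] [N cN netN].
exists [set f @` (P.1 `*` P.2) | P in M `*` N].
  by apply: (card_le_trans (card_image_le _ _)); exact: countableX.
move=> _ U [[y z] [/= Yy Zz] <-] /cf [[A B] [/= nA nB] ABU].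
have [P [MP Py PA]] := netM _ _ Yy nA.
have [Q [NQ Qz QB]] := netN _ _ Zz nB.
exists (f @` (P `*` Q)); split; first by exists (P, Q).
  by exists (y, z).
by move=> _ [[p q] [/= Pp Qq] <-]; apply: ABU; split; [exact: PA|exact: QB].
Qed.

Lemma countable_network_image (T V : topologicalType) (f : T -> V) (Y : set T) :
  continuous f -> countable_network Y -> countable_network (f @` Y).
Proof.
move=> cf [N cN netN].
exists [set f @` P | P in N]; first exact: (card_le_trans (card_image_le _ _)).
move=> _ U [y Yy <-] /cf nU; have [P [NP Py PU]] := netN _ _ Yy nU.
by exists (f @` P); split; [exists P|exists y|move=> _ [p /PU ? <-]].
Qed.

Lemma countable_network_bigcup (T : topologicalType) (Y : nat -> set T) :
  (forall n, countable_network (Y n)) ->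
  countable_network (\bigcup_n Y n).
Proof.
move=> netY; have /choice[N NP] : forall n, exists N : set (set T), countable N /\
    forall y U, Y n y -> nbhs y U -> exists S, [/\ N S, S y & S `<=` U].
  by move=> n; have [N] := netY n; exists N.
exists (\bigcup_n N n).
  by apply: bigcup_countable => // n _; have [] := NP n.
move=> y U [n _ Yny] nU; have [_ /(_ _ _ Yny nU) [S [NS Sy SU]]] := NP n.
by exists S; split => //; exists n.
Qed.

Lemma countable_network_set1 (T : topologicalType) (x : T) :
  countable_network [set x].
Proof.
exists [set [set x]]; first exact: countable1.
move=> _ U -> nU; exists [set x]; split => // _ ->.
exact: nbhs_singleton.
Qed.

(** The balls of radius 1/(n+1) around the points of a countable dense set. *)
Lemma separable_countable_network (R : realType) (M : pseudoMetricType R) :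
  separable M -> countable_network [set: M].
Proof.
move=> [D cD dD].
exists [set ball p.1 (p.2.+1%:R^-1 : R) | p in D `*` [set: nat]].
  by apply: (card_le_trans (card_image_le _ _)); exact: countableX.
move=> y U _ /nbhs_ballP [e /= e0 yeU].
have e20 : 0 < e / 2 by rewrite divr_gt0.
have [n] := ltr_add_invr e20; rewrite add0r => ne.
have n0 : 0 < (n.+1%:R^-1 : R) by rewrite invr_gt0.
have /dD : interior (ball y (n.+1%:R^-1 : R)) !=set0.
  by exists y; exact: nbhsx_ballx.
move=> /(_ (open_interior _)) [d [/interior_subset yd Dd]].
exists (ball d (n.+1%:R^-1 : R)); split; first by exists (d, n).
  exact: ball_sym.
move=> z dz; apply: yeU; rewrite (splitr e).
by apply: (le_ball _ (ball_triangle yd dz)); rewrite lerD// ltW.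
Qed.

Lemma realType_separable (R : realType) : separable R.
Proof.
exists (@ratr R @` setT); last exact: dense_rat.
by apply: (card_le_trans (card_image_le _ _)); exact: countableP.
Qed.

Lemma separable_image (S T : topologicalType) (h : S -> T) :
  continuous h -> range h = setT -> separable S -> separable T.
Proof.
move=> /continuousP ch surj [D cD dD]; exists (h @` D).
  exact: (card_le_trans (card_image_le _ _)).
move=> O [y Oy] /ch oO.
have [x _ hx] : range h y by rewrite surj.
have [||d [Od Dd]] := dD (h @^-1` O); rewrite //; first by exists x; rewrite /= hx.
by exists (h d); split => //; exists d.
Qed.

(** * The span of a separable space in a topological vector space *)

Section SpanNetwork.
Variables (R : realType) (M : topologicalType) (V : topologicalLmodType R).
Variable i : M -> V.

Fixpoint combinations n : set V :=
  if n is n'.+1 then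
    [set p.1 + p.2 | p in combinations n' `*`
      [set q.1 *: i q.2 | q in [set: R^o] `*` [set: M]]]
  else [set 0].

Lemma combinations_closed :
  GRing.subsemimod_closed (fun v => v \in \bigcup_n combinations n).
Proof.
split; first split.
- by apply/mem_set; exists 0%N.
- move=> u v /set_mem[m _ mu] /set_mem[n _ nv]; apply/mem_set.
  elim: n v nv => [|n IHn] v /=; first by move=> ->; rewrite addr0; exists m.
  move=> [[w t] [/= /IHn [k _ kuw] Lt] <-]; exists k.+1 => //=.
  by exists (u + w, t) => //=; rewrite addrA.
- move=> a v /set_mem[n _ nv]; apply/mem_set.
  elim: n v nv => [|n IHn] v /=; first by move=> ->; rewrite scaler0; exists 0%N.
  move=> [[w _] [/= /IHn [k _ kaw] [[b x] _ <-]] <-]; exists k.+1 => //=.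
  exists (a *: w, (a * b) *: i x) => /=; last by rewrite scalerDr scalerA.
  by split => //; exists (a * b, x).
Qed.

Lemma combinations1 x : combinations 1 (i x).
Proof.
exists (0, i x); last by rewrite add0r.
by split => //; exists (1, x); rewrite //= scale1r.
Qed.

(** [combinations n.+1] is the image of [combinations n], R and M under a
    jointly continuous map, so networks propagate by induction on [n]. *)
Lemma combinations_network : continuous i ->
  countable_network [set: M] -> countable_network (\bigcup_n combinations n).
Proof.
move=> ci netM; apply: countable_network_bigcup; elim=> [|n IHn] /=.
  exact: countable_network_set1.
apply: (countable_network_image2 (f := fun p : V * V => p.1 + p.2)) => //.
  exact: add_continuous.
apply: (countable_network_image2 (f := fun p : R^o * M => p.1 *: i p.2)) => //.
  move=> x; apply: (@continuous_comp _ _ _ (fun x : R^o * M => (x.1, i x.2))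
    (fun x : R^o * V => x.1 *: x.2)); last exact: scale_continuous.
  apply: (@cvg_pair _ _ _ _ (nbhs (x.1 : R^o)) (nbhs (i x.2))) => /=.
    exact: cvg_fst.
  apply: (@continuous_comp (R^o * M)%type M V snd i); first exact: cvg_snd.
  exact: ci.
apply: (@separable_countable_network R R^o); exact: realType_separable.
Qed.
End SpanNetwork.

Lemma free_tvs_countable_tightness (R : realType) (X : topologicalType)
    (V : topologicalLmodType R) (i : X -> V) :
  is_free_tvs i -> countable_network [set: X] -> countable_tightness V.
Proof.
move=> freeV netX; apply: countable_network_tightness.
have -> : [set: V] = \bigcup_n combinations i n.
  apply/esym/seteqP; split => // v _; apply/set_mem.
  apply: (free_tvs_spanned freeV (combinations_closed i)) => x.
  by apply/mem_set; exists 1%N => //; exact: combinations1.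
by have [_ ci _] := freeV; exact: combinations_network.
Qed.

(** * Uncountable families of reals and separated families *)

Lemma realType_uncountable (R : realType) : ~ countable [set: R].
Proof.
move=> /countable_lebesgue_measure0.
by rewrite -set_itvNyy lebesgue_measure_itv.
Qed.


(** Zorn's lemma is applied to sets of points paired with real labels, for each
    scale 1/(n+1).  If all the maximal sets were countable, a label would
    always be left over, so maximality would force their points to be
    1/(n+1)-dense, and the union over n would be a countable dense set.  The
    labels stand in for an injection of the first uncountable ordinal into the
    reals: a separated set may well have more points than the continuum. *)
Lemma nonseparable_separated (R : realType) (M : metricType R) :
  ~ separable M -> exists2 e : R, 0 < e & exists2 G : set (M * R), ~ countable G &
    forall p q, G p -> G q -> p <> q -> e <= mdist p.1 q.1 /\ p.2 <> q.2.
Proof.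
move=> nsep; apply: contrapT => noG; apply: nsep.
pose P (e : R) : set (set (M * R)) := [set G | 
    forall p q, G p -> G q -> p <> q -> e <= mdist p.1 q.1 /\ p.2 <> q.2].
have zorn e : exists G, P e G /\ forall B, G `<` B -> ~ P e B.
  apply: Zorn_bigcup => F FP totF p q [A FA Ap] [B FB Bq].
  have [AB|BA] := totF _ _ FA FB.
    by apply: (FP _ FB) => //; exact: AB.
  by apply: (FP _ FA) => //; exact: BA.
have /choice [G GP] : forall n : nat, exists G, P (n.+1%:R^-1) G /\
  forall B, G `<` B -> ~ P (n.+1%:R^-1) B by move=> n; exact: zorn.
have e0 n : 0 < (n.+1%:R^-1 : R) by rewrite invr_gt0.
have cG n : countable (G n).
  apply: contrapT => nc; apply: noG; exists n.+1%:R^-1 => //.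
  by exists (G n) => //; have [] := GP n.
exists (\bigcup_n fst @` G n).
  apply: bigcup_countable => // n _.
  by apply: (card_le_trans (card_image_le _ _)); exact: cG.
move=> O [x Ox] oO.
have /nbhs_ballP[e /= egt0 xeO] : nbhs x O by exact: open_nbhs_nbhs.
have [n] := ltr_add_invr egt0; rewrite add0r => ne.
apply: contrapT => OG.
have far p : G n p -> n.+1%:R^-1 <= mdist p.1 x.
  move=> Gp; rewrite leNgt; apply/negP => px; apply: OG; exists p.1; split.
    by apply: xeO; rewrite ballEmdist/= metric_sym (lt_trans px).
  by exists n => //; exists p.
have [r nr] : exists r, ~ (snd @` G n) r.
  apply: contrapT => /forallNP allr; apply: (@realType_uncountable R).
  apply: (sub_countable (subset_card_le (B := snd @` G n) _)).
    by move=> r _; apply: contrapT; exact: allr.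
  by apply: (card_le_trans (card_image_le _ _)); exact: cG.
have [PG maxG] := GP n.
apply: (maxG (G n `|` [set (x, r)])).
  split; first by left.
  move=> /(_ (x, r) (or_intror erefl)) Gxr; apply: nr.
  by exists (x, r).
move=> p q [Gp|->] [Gq|->] //.
- exact: PG.
- by move=> _; split; [exact: far|move=> pr; apply: nr; exists p].
- by move=> _; split; [rewrite metric_sym; exact: far|
    move=> pr; apply: nr; exists q].
Qed.

Lemma mdist_continuous (R : realType) (M : metricType R) (p : M) :
  continuous (mdist p : M -> R).
Proof.
move=> z; apply/cvgrPdist_lt => d d0.
apply: filterS (nbhsx_ballx z d d0) => y; rewrite ballEmdist /= => zy.
rewrite (le_lt_trans _ zy)// ler_norml.
have := metric_triangle p z y; have := metric_triangle p y z.
by rewrite (metric_sym y z) => *; apply/andP; split; lra.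
Qed.

(** The function is a sum of bumps of radius e/4 centred at the points.  The
    balls of radius e/2 are pairwise disjoint, and a ball of radius e/8 meets
    the support of at most one bump, so the sum is locally a single bump or
    zero. *)
Lemma separated_interpolation (R : realType) (M : metricType R) (T : choiceType)
    (G : set T) (x : T -> M) (a : T -> R) (e : R) :
  0 < e -> (forall p q, G p -> G q -> p <> q -> e <= mdist (x p) (x q)) ->
  exists2 f : M -> R, continuous f & forall p, G p -> f (x p) = a p.
Proof.
move=> e0 sep; have e40 : 0 < e / 4 by rewrite divr_gt0.
pose bump p z := a p * Num.max 0 (1 - mdist (x p) z / (e / 4)).
have bump0 p z : e / 4 <= mdist (x p) z -> bump p z = 0.
  move=> pz; rewrite /bump max_l ?mulr0// subr_le0 ler_pdivlMr// mul1r//.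
have cbump p : continuous (bump p).
  move=> z; apply: cvgM; first exact: cvg_cst.
  apply: (@continuous_max R M (fun=> 0) (fun z => 1 - mdist (x p) z / (e / 4))).
    exact: cvg_cst.
  apply: cvgB; first exact: cvg_cst.
  by apply: cvgM; [exact: mdist_continuous|exact: cvg_cst].

have near_uniq z p q : G p -> G q -> mdist (x p) z < e / 2 ->
    mdist (x q) z < e / 2 -> p = q.
  move=> Gp Gq pz qz; apply: contrapT => /(sep _ _ Gp Gq).
  apply/negP; rewrite -ltNge (le_lt_trans (metric_triangle _ z _))//.
  by rewrite [e]splitr ltrD// metric_sym.
pose P z p := G p /\ mdist (x p) z < e / 2.
(* At most one bump is nonzero at z, so the sum is the value of the bump
   whose centre is within e/2 of z, if there is one. *)
pose f z := if pselect (exists p, P z p) is left ex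
            then bump (projT1 (cid ex)) z else 0.
have fE z p : G p -> mdist (x p) z < e / 2 -> f z = bump p z.
  move=> Gp pz; rewrite /f; case: pselect => [ex|[]]; last by exists p.
  by case: cid => q /= [Gq qz]; rewrite (near_uniq z p q).
have f0 z : (forall p, G p -> e / 4 <= mdist (x p) z) -> f z = 0.
  move=> far; rewrite /f; case: pselect => [ex|//].
  by case: cid => q /= [Gq qz]; exact/bump0/far.
exists f; last first.
  move=> p Gp; rewrite (fE _ p)// ?mdistxx ?divr_gt0//.
  by rewrite /bump mdistxx mul0r subr0 max_r// mulr1.
move=> z.
have e80 : 0 < e / 8 by rewrite divr_gt0.
have nz : nbhs z (ball z (e / 8)) by exact: nbhsx_ballx.
have [[p [Gp pz]]|nop] := pselect (exists p, G p /\ mdist (x p) z < e / 4 + e / 8).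
  have fb : {near z, bump p =1 f}.
    apply: filterS nz => y; rewrite ballEmdist /= => zy; apply/esym/fE => //.
    apply: (le_lt_trans (metric_triangle _ z _)); apply: lt_le_trans (ltrD pz zy) _.
    lra.
  rewrite /continuous_at (fE z p)//; last first.
    apply: (lt_le_trans pz); lra.
  exact: cvg_trans (near_eq_cvg fb) (cbump p z).
have f0z : {near z, (fun=> 0) =1 f}.
  apply: filterS nz => y; rewrite ballEmdist /= => zy; apply/esym/f0 => p Gp.
  rewrite leNgt; apply/negP => py; apply: nop; exists p; split => //.
  by rewrite (le_lt_trans (metric_triangle _ y _))// ltrD// metric_sym.
rewrite /continuous_at f0.
  exact: cvg_trans (near_eq_cvg f0z) (cvg_cst _).
move=> p Gp; rewrite leNgt; apply/negP => pz; apply: nop; exists p; split=> //.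
by rewrite (lt_le_trans pz)// lerDl ltW.
Qed.

(** Along an enumeration of [C], let [a p] dominate the finitely many values
    [c p q] with [q] enumerated before [p]. *)
Lemma countable_domination (R : realType) (T : choiceType) (C : set T)
    (c : T -> T -> R) :
  countable C -> (forall p q, c p q = c q p) ->
  exists a : T -> R, forall p q, C p -> C q -> p <> q -> c p q <= a p + a q.
Proof.
move=> /countable_injP[n injn] csym.
pose g p m := xget p [set q | C q /\ n q = m].
pose a p := \sum_(m < n p) `|c p (g p m)|.
have a_ge0 p : 0 <= a p by exact: sumr_ge0.
have aP p q : C q -> (n q < n p)%N -> c p q <= a p.
  move=> Cq qp; rewrite /a (bigD1 (Ordinal qp))//= (_ : g p (n q) = q).
    by rewrite (le_trans (ler_norm _))// lerDl sumr_ge0.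
  apply: xget_unique => // r [Cr nrq].
  by apply: injn; rewrite ?inE.
exists a => p q Cp Cq pq.
have [npq|nqp|npq] := ltngtP (n p) (n q).
- by rewrite csym (le_trans (aP _ _ Cp npq))// lerDr.
- by rewrite (le_trans (aP _ _ Cq nqp))// lerDl.
- by case: pq; apply: injn; rewrite ?inE.
Qed.

(** Otherwise the points would be told apart by which interval of length [d]
    their values lie in, and there are countably many intervals. *)
Lemma uncountable_close_pair (R : realType) (T : Type) (S : set T) (r : T -> R)
    (d : R) :
  ~ countable S -> 0 < d ->
  exists p q, [/\ S p, S q, p <> q & `|r p - r q| < d].
Proof.
move=> nS d0; apply: contrapT => nopair; apply: nS.
apply/countable_injP; exists (pickle \o (fun p => Num.floor (r p / d))).
move=> p q /set_mem Sp /set_mem Sq /(pcan_inj pickleK) fpq.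
apply: contrapT => pq; apply: nopair; exists p, q; split => //.
have := floor_itv (r p / d); have := floor_itv (r q / d); rewrite fpq.
rewrite intrD mulr1z !ler_pdivlMr// !ltr_pdivrMr// => /andP[a b] /andP[u w].
rewrite ltr_norml; apply/andP; split; nra.
Qed.

(** The coefficient |r p - r q| is what a single neighbourhood of 0 cannot keep
    bounded away from 0: the multiples of [v p] are absorbed below a threshold
    depending on [p], but this threshold is uniform on an uncountable set. *)
Lemma closure_scaled_sums (R : realType) (V : topologicalLmodType R) (T : Type)
    (G : set T) (r : T -> R) (v : T -> V) :
  ~ countable G ->
  closure [set w | exists p q, [/\ G p, G q, p <> q &
    w = `|r p - r q| *: (v p + v q)]] 0.
Proof.
move=> nG U U0.
have := @add_continuous V (0, 0) U; rewrite /= addr0 => /(_ U0).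
move=> [[W1 W2] /= [nW1 nW2] WU].
pose W := W1 `&` W2; have nW : nbhs 0 W by exact: filterI.
pose S k := [set p | G p /\ forall t : R, `|t| < k.+1%:R^-1 -> W (t *: v p)].
have GS : G `<=` \bigcup_k S k.
  move=> p Gp.
  have := @scale_continuous R V (0, v p) W; rewrite /= scale0r => /(_ nW).
  move=> [[A B] /= [nA nB] ABW].
  have /nbhs_ballP[e /= egt0 eA] := nA.
  have [k] := ltr_add_invr egt0; rewrite add0r => ke.
  exists k => //; split => // t tk; apply: (ABW (t, v p)); split => /=.
    by apply: eA; rewrite /ball /= sub0r normrN (lt_trans tk).
  exact: nbhs_singleton.
have [k nSk] : exists k, ~ countable (S k).
  apply: contrapT => /forallNP allk; apply: nG.
  apply: (sub_countable (subset_card_le GS)); apply: bigcup_countable => // k _.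
  by apply: contrapT; exact: allk.
have k0 : 0 < (k.+1%:R^-1 : R) by rewrite invr_gt0.
have [p [q [[Gp Wp] [Gq Wq] pq rpq]]] := uncountable_close_pair r nSk k0.
exists (`|r p - r q| *: (v p + v q)); split; first by exists p, q.
rewrite scalerDr; apply: (WU (_, _)); split => /=.
  by have [] := Wp (`|r p - r q|); rewrite ?normr_id.
by have [] := Wq (`|r p - r q|); rewrite ?normr_id.
Qed.

(** * The free topological vector space *)

(** The homeomorphism between [X] and [M] is kept explicit: vectors come from
    points of [M] through [k], and functions on [M] are pulled back along [h]. *)
Lemma free_tvs_separable (R : realType) (X : topologicalType)
    (M : metricType R) (h : X -> M) (k : M -> X)
    (V : topologicalLmodType R) (i : X -> V) :
  cancel k h -> continuous h -> is_free_tvs i -> countable_tightness V ->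
  separable M.
Proof.
move=> kK ch [hV ci univ] tightV; apply: contrapT.
move=> /nonseparable_separated[e e0 [G nG sepG]].
have [B [cB BA clB]] := tightV _ _
  (closure_scaled_sums (fun p : M * R => p.2) (fun p => i (k p.1)) nG).
(* A pair of points producing each vector of B; their collection C is
   countable. *)
have /choice[s sP] : forall w, exists pq : (M * R) * (M * R), B w ->
    [/\ G pq.1, G pq.2, pq.1 <> pq.2 &
      w = `|pq.1.2 - pq.2.2| *: (i (k pq.1.1) + i (k pq.2.1))].
  move=> w; have [/BA [p [q H]]|nBw] := pselect (B w); first by exists (p, q).
  have [p _] : G !=set0.
    by apply/set0P/eqP => G0; apply: nG; rewrite G0.
  by exists (p, p).
pose C := [set if wb.2 then (s wb.1).1 else (s wb.1).2 | wb in B `*` [set: bool]].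
have cC : countable C.
  by apply: (card_le_trans (card_image_le _ _)); exact: countableX.
have CG : C `<=` G by move=> _ [[w []] [/= /sP[? ? _ _] _] <-].
have [a aP] := countable_domination (c := fun p q : M * R => `|p.2 - q.2|^-1)
  cC (fun p q => congr1 GRing.inv (distrC _ _)).
have [f cf fP] := separated_interpolation (x := fst) a e0
  (fun p q Cp Cq pq => (sepG p q (CG _ Cp) (CG _ Cq) pq).1).
have cfh : continuous (f \o h : X -> R^o).
  by move=> x; apply: continuous_comp; [exact: ch|exact: cf].
have [g [[lg cg fE] _]] := univ R^o (f \o h) (@metric_hausdorff R R^o) cfh.
have gi x : g (i (k x)) = f x.
  by have /= := congr1 (fun u => u (k x)) fE; rewrite kK => <-.
have lgD u v : g (u + v) = g u + g v.
  by have := lg 1 u v; rewrite !scale1r.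
have g00 : g 0 = 0 by apply: (addrI (g 0)); rewrite -lgD !addr0.
have lgZ t u : g (t *: u) = t * g u.
  by have := lg t u 0; rewrite g00 !addr0.
have n0 : nbhs 0 [set v | (g v : R) < 1].
  have : nbhs (g 0) [set y : R | y < 1].
    by rewrite g00; apply: open_nbhs_nbhs; split; [exact: open_lt|exact: ltr01].
  exact: cg.
have [w [Bw /=]] := clB _ n0; apply/negP; rewrite -leNgt.
have [G1 G2 ne ->] := sP _ Bw.
have C1 : C (s w).1 by exists (w, true).
have C2 : C (s w).2 by exists (w, false).
rewrite lgZ lgD !gi !fP//.
have d0 : 0 < `|(s w).1.2 - (s w).2.2|.
  by rewrite normr_gt0 subr_eq0; apply/eqP; exact: (sepG _ _ G1 G2 ne).2.
by rewrite mulrC -ler_pdivrMr// div1r; exact: aP.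
Qed.

Theorem theorem4p25 (R : realType) (X : topologicalType)
  (V : topologicalLmodType R) (i : X -> V)
  (metrX : metrizable R X) (freeV : is_free_tvs i) :
  countable_tightness V <-> separable X.
Proof.
have [M [h [k [hK kK ch ck]]]] := metrX.
split => [tightV|sepX].
  apply: (separable_image (h := k)) => //.
    by apply/seteqP; split => // x _; exists (h x).
  exact: (free_tvs_separable kK ch freeV).
apply: (free_tvs_countable_tightness freeV).
have -> : [set: X] = k @` setT.
  by apply/esym/seteqP; split => // x _; exists (h x).
apply: countable_network_image => //; apply: separable_countable_network.
apply: (separable_image (h := h)) => //.
by apply/seteqP; split => // y _; exists (k y).
Qed.
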